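(* Let $l\ge 2$. The action of the extended affine Weyl group $\widetilde W=\langle s_0,\ldots,s_l,\pi\rangle$ of type $A^{(1)}_l$ on $\mathbb{C}(\alpha;f)$ commutes with the derivation $'$ of the differential field $\mathbb{C}(\alpha;f)$; that is, $w(\varphi')=w(\varphi)'$ for all $w\in\widetilde W$ and all $\varphi\in\mathbb{C}(\alpha;f)$.
   Context: Let $l\ge 2$ be an integer. All indices $0,1,\ldots,l$ are understood as elements of $\mathbb{Z}/(l+1)\mathbb{Z}$. $\mathbb{C}(\alpha;f)$ is the field of rational functions in the independent variables $\alpha=(\alpha_0,\ldots,\alpha_l)$ and $f=(f_0,\ldots,f_l)$; put $k=\alpha_0+\cdots+\alpha_l$. Derivation: $'$ is the $\mathbb{C}$-linear derivation of $\mathbb{C}(\alpha;f)$ with $\alpha_j'=0$ and with $f_j'$ given as follows. If $l=2n$ ($n\ge1$), for $0\le j\le 2n$, $$f_j'=f_j\Big(\sum_{1\le r\le n}f_{j+2r-1}-\sum_{1\le r\le n}f_{j+2r}\Big)+\alpha_j.$$ If $l=2n+1$ ($n\ge1$), for $0\le j\le 2n+1$, $$f_j'=f_j\Big(\sum_{1\le r\le s\le n}f_{j+2r-1}f_{j+2s}-\sum_{1\le r\le s\le n}f_{j+2r}f_{j+2s+1}\Big)+\Big(\frac{k}{2}-\sum_{1\le r\le n}\alpha_{j+2r}\Big)f_j+\alpha_j\Big(\sum_{1\le r\le n}f_{j+2r}\Big).$$ Action: for $i=0,\ldots,l$, $s_i$ is the $\mathbb{C}$-automorphism of $\mathbb{C}(\alpha;f)$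 with $s_i(\alpha_i)=-\alpha_i$, $s_i(\alpha_j)=\alpha_j+\alpha_i$ for $j=i\pm1$, $s_i(\alpha_j)=\alpha_j$ for $j\ne i,i\pm1$; $s_i(f_i)=f_i$, $s_i(f_{i+1})=f_{i+1}+\alpha_i/f_i$, $s_i(f_{i-1})=f_{i-1}-\alpha_i/f_i$, $s_i(f_j)=f_j$ for $j\neq i,i\pm1$. $\pi$ is the $\mathbb{C}$-automorphism with $\pi(\alpha_j)=\alpha_{j+1}$, $\pi(f_j)=f_{j+1}$. It is known that these automorphisms satisfy the defining relations of the extended affine Weyl group of type $A^{(1)}_l$: $s_i^2=1$, $s_is_j=s_js_i$ ($j\ne i,i\pm1$), $s_is_js_i=s_js_is_j$ ($j=i\pm1$), $\pi^{l+1}=1$, $\pi s_i=s_{i+1}\pi$. *)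

(* Defs.v *)
From HB Require Import structures.
From mathcomp Require Import all_boot all_order all_algebra.
From mathcomp Require Import generic_quotient fraction complex mpoly reals.
From mathcomp Require Import ring.

Set Implicit Arguments.
Unset Strict Implicit.
Unset Printing Implicit Defensive.

Import GRing.Theory.
Local Open Scope ring_scope.

Notation ratfun F n := {fraction {mpoly F[n]}}.

Section FieldIdentities.
Context (E : fieldType).
Implicit Types a b c d r : E.

Lemma divfB_frac a b c d :
  b != 0 -> d != 0 -> a / b - c / d = (a * d - c * b) / (b * d).
Proof. by move=> b0 d0; field; rewrite b0 d0. Qed.

Lemma lin_frac k a b c d :
  b != 0 -> d != 0 -> k * (a / b) + c / d = (k * a * d - (- c) * b) / (b * d).
Proof. by move=> b0 d0; field; rewrite b0 d0. Qed.

Lemma quot_rule_eq a a' b b' c c' d d' :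
  b != 0 -> d != 0 -> a * d = b * c ->
  a' * d + a * d' = b' * c + b * c' ->
  (c' * d - c * d') / d ^+ 2 = (a' * b - a * b') / b ^+ 2.
Proof.
move=> b0 d0 e e'.
have {}e' : b * c' = a' * d + a * d' - b' * c by rewrite e'; ring.
apply/eqP; rewrite eqr_div ?expf_neq0 //; apply/eqP.
transitivity (b * c' * (b * d) - b * c * (b * d')); first by ring.
rewrite e'.
transitivity (a' * b * d ^+ 2 + a * d * d' * b
  - b' * d * (b * c) - b * c * (b * d')); first by ring.
by rewrite -e; ring.
Qed.

Lemma quot_rule_lin k a a' b b' c c' d d' : b != 0 -> d != 0 ->
  (((0 * a + k * a') * d + k * a * d' - ((- c') * b + (- c) * b')) * (b * d)
    - (k * a * d - (- c) * b) * (b' * d + b * d')) / (b * d) ^+ 2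
  = k * ((a' * b - a * b') / b ^+ 2) + (c' * d - c * d') / d ^+ 2.
Proof. by move=> b0 d0; field; rewrite b0 d0. Qed.

Lemma quot_rule_mul a a' b b' c c' d d' : b != 0 -> d != 0 ->
  ((a' * c + a * c') * (b * d) - a * c * (b' * d + b * d')) / (b * d) ^+ 2
  = (a' * b - a * b') / b ^+ 2 * (c / d) + a / b * ((c' * d - c * d') / d ^+ 2).
Proof. by move=> b0 d0; field; rewrite b0 d0. Qed.

End FieldIdentities.

Section RatFun.
Context (F : fieldType) (n : nat).
Local Notation P := {mpoly F[n]}.
Local Notation K := (ratfun F n).
Local Notation "p %:F" := (@FracField.tofrac P p).
Implicit Types (v : 'I_n -> K) (p q : P) (x y : K).

Definition rconst (c : F) : K := c%:MP_[n]%:F.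

Lemma rconst_is_zmod_morphism : zmod_morphism rconst.
Proof. by move=> a b; rewrite /rconst mpolyCB tofracB. Qed.

Lemma rconst_is_monoid_morphism : monoid_morphism rconst.
Proof. by split=> [|a b]; rewrite /rconst ?mpolyC1 ?tofrac1 // mpolyCM tofracM. Qed.

HB.instance Definition _ :=
  GRing.isZmodMorphism.Build F K rconst rconst_is_zmod_morphism.
HB.instance Definition _ :=
  GRing.isMonoidMorphism.Build F K rconst rconst_is_monoid_morphism.

Definition automorphism_over (s : K -> K) : Prop :=
  [/\ zmod_morphism s, monoid_morphism s,
      forall c, s (rconst c) = rconst c & bijective s].

Definition derivation_over (D : K -> K) : Prop :=
  (forall c x y, D (rconst c * x + y) = rconst c * D x + D y) /\
  (forall x y, D (x * y) = D x * y + x * D y).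

(* Substitution X_j |-> v j. It is meaningful only when the v j are
   algebraically independent: otherwise a denominator may be sent to 0,
   and the quotient is then the junk value 0. *)
Definition rsubst v x : K :=
  mmap rconst v (\n_(repr x)) / mmap rconst v (\d_(repr x)).

(* The derivation that is zero on constants and sends X_j to v j, by the
   chain rule on polynomials and the quotient rule on fractions. *)
Definition pder v p : K := \sum_(j < n) (p^`M(j))%:F * v j.

Definition rder v x : K :=
  (pder v (\n_(repr x)) * (\d_(repr x))%:F
   - (\n_(repr x))%:F * pder v (\d_(repr x))) / (\d_(repr x))%:F ^+ 2.

Lemma numdenK x : x = (\n_(repr x))%:F / (\d_(repr x))%:F.
Proof.
have d0 : (\d_(repr x))%:F != 0 by rewrite tofrac_eq0 denom_ratioP.
apply: (mulIf d0); rewrite divfK // -{1}[x]reprK.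
unlock FracField.tofrac; rewrite -[LHS]FracField.pi_mul /FracField.mulf /=.
apply/eqmodP; rewrite /= FracField.equivfE.
rewrite !numden_Ratio ?(mulr1, mul1r, oner_neq0) ?denom_ratioP //.
by rewrite mulrC.
Qed.

Lemma eq_fracP p q x :
  q != 0 -> x = p%:F / q%:F -> p * \d_(repr x) = q * \n_(repr x).
Proof.
move=> q0 e; apply/eqP; rewrite -tofrac_eq !tofracM.
have d0 : (\d_(repr x))%:F != 0 by rewrite tofrac_eq0 denom_ratioP.
have e2 := numdenK x; rewrite {1}e in e2.
have q0' : q%:F != 0 by rewrite tofrac_eq0.
by rewrite [eqbRHS]mulrC -(eqr_div _ _ q0' d0) -e2.
Qed.

Lemma ratP x : exists p q, q != 0 /\ x = p%:F / q%:F.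
Proof.
by exists \n_(repr x), \d_(repr x); split; [exact: denom_ratioP | exact: numdenK].
Qed.

Lemma rsubst_frac v p q :
  injective (mmap rconst v) -> q != 0 ->
  rsubst v (p%:F / q%:F) = mmap rconst v p / mmap rconst v q.
Proof.
move=> inj q0; set x := _ / _.
have nz r : r != 0 -> mmap rconst v r != 0.
  by move=> r0; rewrite -(rmorph0 (mmap rconst v)) (inj_eq inj).
have := congr1 (mmap rconst v) (eq_fracP q0 (erefl x)).
rewrite !rmorphM /= => e; apply/eqP.
by rewrite /rsubst eqr_div ?nz ?denom_ratioP // [_ * mmap _ _ q]mulrC -e.
Qed.

Lemma rsubst_poly v p :
  injective (mmap rconst v) -> rsubst v p%:F = mmap rconst v p.
Proof.
by move=> inj; rewrite -[p%:F]divr1 -tofrac1 rsubst_frac ?oner_neq0 // rmorph1 divr1.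
Qed.

Lemma rsubst_automorphism v (w : 'I_n -> K) :
  injective (mmap rconst v) -> injective (mmap rconst w) ->
  (forall j, rsubst v (w j) = ('X_j)%:F) -> (forall j, rsubst w (v j) = ('X_j)%:F) ->
  automorphism_over (rsubst v).
Proof.
have nz u r : injective (mmap rconst u) -> r != 0 -> mmap rconst u r != 0.
  by move=> inj r0; rewrite -(rmorph0 (mmap rconst u)) (inj_eq inj).
have zmodP u : injective (mmap rconst u) -> zmod_morphism (rsubst u).
  move=> inj x y; have [p [q [q0 ->]]] := ratP x; have [r [t [t0 ->]]] := ratP y.
  have -> : p%:F / q%:F - r%:F / t%:F = (p * t - r * q)%:F / (q * t)%:F.
    by rewrite divfB_frac ?tofrac_eq0 // !tofracM tofracB !tofracM.
  rewrite !rsubst_frac ?mulf_neq0 // rmorphB !rmorphM /=.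
  by rewrite divfB_frac ?nz.
have monP u : injective (mmap rconst u) -> monoid_morphism (rsubst u).
  move=> inj; split.
    by rewrite -tofrac1 rsubst_poly // rmorph1.
  move=> x y; have [p [q [q0 ->]]] := ratP x; have [r [t [t0 ->]]] := ratP y.
  have -> : p%:F / q%:F * (r%:F / t%:F) = (p * r)%:F / (q * t)%:F.
    by rewrite mulf_div !tofracM.
  rewrite !rsubst_frac ?mulf_neq0 // !rmorphM /=.
  by rewrite mulf_div.
have cstP u c : injective (mmap rconst u) -> rsubst u (rconst c) = rconst c.
  by move=> inj; rewrite rsubst_poly // mmapC.
have canP (u u' : 'I_n -> K) : injective (mmap rconst u) ->
    injective (mmap rconst u') -> (forall j, rsubst u' (u j) = ('X_j)%:F) ->
    cancel (rsubst u) (rsubst u').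
  move=> inj inj' uu' x; have [p [q [q0 ->]]] := ratP x.
  pose f : {rmorphism K -> K} := HB.pack (rsubst u')
    (GRing.isZmodMorphism.Build _ _ _ (zmodP u' inj'))
    (GRing.isMonoidMorphism.Build _ _ _ (monP u' inj')).
  have fE r : f (mmap rconst u r) = r%:F.
    elim/mpolyind: r => [|c m r _ _ IH]; first by rewrite !rmorph0.
    rewrite mmapD (rmorphD f) IH tofracD; congr (_ + _).
    rewrite mmapZ mmapX (rmorphM f) -mul_mpolyC tofracM; congr (_ * _).
      exact: cstP.
    rewrite /mmap1 rmorph_prod mpolyXE_id rmorph_prod.
    by apply: eq_bigr => j _; rewrite !rmorphXn /= uu'.
  rewrite rsubst_frac // -[rsubst u' _]/(f _) fmorph_div.
  by rewrite !fE.
move=> injv injw vw wv; split; [exact: zmodP|exact: monP| |].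
  by move=> c; apply: cstP.
by exists (rsubst w); apply: canP.
Qed.

Lemma pderB v : {morph pder v : p q / p - q}.
Proof.
move=> p q; rewrite /pder -sumrB; apply: eq_bigr => j _.
by rewrite mderivB tofracB mulrBl.
Qed.

Lemma pderM v p q : pder v (p * q) = pder v p * q%:F + p%:F * pder v q.
Proof.
rewrite /pder mulr_suml mulr_sumr -big_split; apply: eq_bigr => j _ /=.
by rewrite mderivM tofracD !tofracM mulrDl mulrAC mulrA.
Qed.

Lemma pderC v c : pder v c%:MP = 0.
Proof. by rewrite /pder big1 // => j _; rewrite mderivC tofrac0 mul0r. Qed.

Lemma pderX v j : pder v 'X_j = v j.
Proof.
rewrite /pder (bigD1 j) //= big1 ?addr0 => [|i ij].
  rewrite mderivX mnm1E eqxx scale1r.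
  have -> : (U_(j) - U_(j))%MM = 0%MM :> 'X_{1..n}.
    by apply/mnmP => k; rewrite mnmBE mnm0E subnn.
  by rewrite mpolyX0 tofrac1 mul1r.
by rewrite mderivX mnm1E eq_sym (negbTE ij) scale0r tofrac0 mul0r.
Qed.

Lemma rder_frac v p q : q != 0 ->
  rder v (p%:F / q%:F) =
  (pder v p * q%:F - p%:F * pder v q) / q%:F ^+ 2.
Proof.
move=> q0; set x := _ / _; have := eq_fracP q0 (erefl x); rewrite /rder.
have := denom_ratioP (repr x); move: (\n_(repr x)) (\d_(repr x)) => r d d0 e.
have e' := congr1 (pder v) e; rewrite !pderM in e'.
have {}e : p%:F * d%:F = q%:F * r%:F by rewrite -!tofracM e.
rewrite -(tofrac_eq0 q) in q0; rewrite -(tofrac_eq0 d) in d0.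
exact: (quot_rule_eq q0 d0 e e').
Qed.

Lemma rder_poly v p : rder v p%:F = pder v p.
Proof.
rewrite -[p%:F]divr1 -tofrac1 rder_frac ?oner_neq0 // -mpolyC1 pderC.
by rewrite mpolyC1 tofrac1 expr1n mulr0 subr0 mulr1 divr1.
Qed.

Lemma rder_X v j : rder v ('X_j)%:F = v j.
Proof. by rewrite rder_poly pderX. Qed.

Lemma rder_derivation v : derivation_over (rder v).
Proof.
split=> [c|] x y; have [p [q [q0 ->]]] := ratP x; have [r [t [t0 ->]]] := ratP y.
  have -> : rconst c * (p%:F / q%:F) + r%:F / t%:F
      = (c%:MP * p * t - (- r) * q)%:F / (q * t)%:F.
    by rewrite lin_frac ?tofrac_eq0 // tofracM tofracB !tofracM tofracN.
  have pderN : pder v (- r) = - pder v r.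
    by rewrite -sub0r pderB -mpolyC0 pderC sub0r.
  rewrite !rder_frac ?mulf_neq0 // pderB !pderM pderC pderN.
  rewrite !tofracM tofracB !tofracM tofracN.
  by rewrite quot_rule_lin ?tofrac_eq0.
have -> : p%:F / q%:F * (r%:F / t%:F) = (p * r)%:F / (q * t)%:F.
  by rewrite mulf_div !tofracM.
rewrite !rder_frac ?mulf_neq0 // !pderM !tofracM.
by rewrite quot_rule_mul ?tofrac_eq0.
Qed.

(* A sufficient criterion for X |-> v to define an automorphism with inverse
   X |-> w: this holds on polynomials after inverting g (resp. h). *)
Definition inverts (v w : 'I_n -> K) (g : P) : Prop :=
  [/\ g != 0, mmap rconst w g = g%:F &
      forall j, exists N q,
        v j * g%:F ^+ N = q%:F /\ mmap rconst w q = ('X_j)%:F * g%:F ^+ N].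

Lemma inverts_poly v w g : inverts v w g -> forall p, exists N q,
  mmap rconst v p * g%:F ^+ N = q%:F /\ mmap rconst w q = p%:F * g%:F ^+ N.
Proof.
move=> [g0 wg vw].
pose Q p := exists N q,
  mmap rconst v p * g%:F ^+ N = q%:F /\ mmap rconst w q = p%:F * g%:F ^+ N.
have QM p q : Q p -> Q q -> Q (p * q).
  move=> [N [p' [e1 e2]]] [M [q' [e3 e4]]]; exists (N + M)%N, (p' * q').
  by rewrite !rmorphM !exprD /= e2 e4 -e1 -e3 mulrACA; split=> //; rewrite mulrACA.
have QC c : Q c%:MP.
  by exists 0%N, c%:MP; rewrite !mmapC expr0 !mulr1.
elim/mpolyind => [|c m p _ _ [N [p' [e1 e2]]]].
  by have := QC 0; rewrite mpolyC0.
have [M [q' [e3 e4]]] : Q (c *: 'X_[m]).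
  rewrite -mul_mpolyC mpolyXE_id; apply: (QM) => //.
  apply: (big_ind Q) => [| |j _]; [by rewrite -mpolyC1 | exact: QM |].
  elim: (m j) => [|k IH]; first by rewrite expr0 -mpolyC1.
  by rewrite exprS; apply: QM => //; rewrite /Q mmapX mmap1U; apply: vw.
exists (N + M)%N, (q' * g ^+ N + p' * g ^+ M).
rewrite !rmorphD !rmorphM !rmorphXn /= e2 e4 wg -e1 -e3 exprD !mulrDl.
by split; congr (_ + _); rewrite -?mulrA; congr (_ * _); rewrite // mulrC.
Qed.

Lemma inverts_inj v w g : inverts v w g -> injective (mmap rconst v).
Proof.
move=> vw; apply: raddf_inj => p p0.
have [N [q []]] := inverts_poly vw p; rewrite p0 mul0r => /esym/eqP.
rewrite tofrac_eq0 => /eqP->; rewrite rmorph0 => /esym/eqP.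
case: vw => g0 _ _; rewrite mulf_eq0 expf_eq0 !tofrac_eq0 (negbTE g0) andbF orbF.
by move/eqP.
Qed.

Lemma inverts_rsubst v w g : inverts v w g -> injective (mmap rconst w) ->
  forall j, rsubst w (v j) = ('X_j)%:F.
Proof.
move=> [g0 wg vw] injw j; have [N [q [e1 e2]]] := vw j.
have gN : g%:F ^+ N != 0 by rewrite expf_neq0 // tofrac_eq0.
have -> : v j = q%:F / (g ^+ N)%:F by rewrite tofracXn -e1 mulfK.
by rewrite rsubst_frac ?expf_neq0 // e2 rmorphXn /= wg mulfK.
Qed.

Lemma rsubst_over v w g h : inverts v w g -> inverts w v h ->
  automorphism_over (rsubst v).
Proof.
move=> vw wv; have iv := inverts_inj vw; have iw := inverts_inj wv.
by apply: (rsubst_automorphism iv iw); apply: inverts_rsubst; eassumption.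
Qed.

Lemma rsubst_X v w g j : inverts v w g -> rsubst v ('X_j)%:F = v j.
Proof.
by move=> /inverts_inj iv; rewrite rsubst_poly // mmapX mmap1U.
Qed.

End RatFun.

Section Action.
Context (R : realType) (l : nat).
Local Notation I := 'I_l.+1.
Local Notation P := {mpoly R[i][l.+1 + l.+1]}.
Local Notation K := (ratfun R[i] (l.+1 + l.+1)).
Local Notation "p %:F" := (@FracField.tofrac P p).

Definition alpha (j : I) : K := ('X_(lshift l.+1 j))%:F.
Definition f (j : I) : K := ('X_(rshift l.+1 j))%:F.

Definition on_gens (a b : I -> K) (v : 'I_(l.+1 + l.+1)) : K :=
  match split v with inl j => a j | inr j => b j end.

(* Addition in 'I_l.+1 is modulo l.+1. *)
Local Notation "j '⊕' k" := (j + inZp k : I) (at level 50).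
Local Notation "j '⊖' k" := (j - inZp k : I) (at level 50).

Definition ksum : K := \sum_j alpha j.

Definition f'_even (n : nat) (j : I) : K :=
  f j * (\sum_(1 <= r < n.+1) f (j ⊕ (2 * r - 1))
         - \sum_(1 <= r < n.+1) f (j ⊕ (2 * r)))
  + alpha j.

Definition f'_odd (n : nat) (j : I) : K :=
  f j * (\sum_(1 <= r < n.+1) \sum_(r <= s < n.+1)
           f (j ⊕ (2 * r - 1)) * f (j ⊕ (2 * s))
         - \sum_(1 <= r < n.+1) \sum_(r <= s < n.+1)
           f (j ⊕ (2 * r)) * f (j ⊕ (2 * s + 1)))
  + (ksum / 2 - \sum_(1 <= r < n.+1) alpha (j ⊕ (2 * r))) * f j
  + alpha j * \sum_(1 <= r < n.+1) f (j ⊕ (2 * r)).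

Definition f' (j : I) : K :=
  if odd l then f'_odd l./2 j else f'_even l./2 j.

Definition D : K -> K := rder (on_gens (fun _ => 0) f').

Definition s_alpha (i j : I) : K :=
  if j == i then - alpha i
  else if (j == i ⊕ 1) || (j == i ⊖ 1) then alpha j + alpha i
  else alpha j.

Definition s_f (i j : I) : K :=
  if j == i ⊕ 1 then f j + alpha i / f i
  else if j == i ⊖ 1 then f j - alpha i / f i
  else f j.

Definition s (i : I) : K -> K := rsubst (on_gens (s_alpha i) (s_f i)).

Definition pi : K -> K :=
  rsubst (on_gens (fun j => alpha (j ⊕ 1)) (fun j => f (j ⊕ 1))).

(* The group of automorphisms of K generated by the s i and pi, i.e. the
   image of the abstract extended affine Weyl group under its action. *)
Inductive ext_affine_weyl : (K -> K) -> Prop :=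
| ext_affine_weyl_s i : ext_affine_weyl (s i)
| ext_affine_weyl_pi : ext_affine_weyl pi
| ext_affine_weyl_id : ext_affine_weyl id
| ext_affine_weyl_comp w1 w2 :
    ext_affine_weyl w1 -> ext_affine_weyl w2 -> ext_affine_weyl (w1 \o w2)
| ext_affine_weyl_inv w w' :
    ext_affine_weyl w -> cancel w w' -> cancel w' w -> ext_affine_weyl w'.

Lemma on_gens_alpha a b j : on_gens a b (lshift l.+1 j) = a j.
Proof. by rewrite /on_gens -[lshift _ _]/(unsplit (inl j)) unsplitK. Qed.

Lemma on_gens_f a b j : on_gens a b (rshift l.+1 j) = b j.
Proof. by rewrite /on_gens -[rshift _ _]/(unsplit (inr j)) unsplitK. Qed.

Lemma D_derivation : derivation_over D.
Proof. exact: rder_derivation. Qed.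

Lemma D_alpha j : D (alpha j) = 0.
Proof. by rewrite /D rder_X on_gens_alpha. Qed.

Lemma D_f j : D (f j) = f' j.
Proof. by rewrite /D rder_X on_gens_f. Qed.

Lemma gens_ind (Q : 'I_(l.+1 + l.+1) -> Prop) :
  (forall j, Q (lshift _ j)) -> (forall j, Q (rshift _ j)) -> forall v, Q v.
Proof. by move=> Ql Qr v; rewrite -[v]splitK; case: (split v). Qed.

Lemma s_inverts i : (2 <= l)%N ->
  inverts (on_gens (s_alpha i) (s_f i)) (on_gens (s_alpha i) (s_f i))
    'X_(rshift l.+1 i).
Proof.
move=> hl; set v := on_gens _ _.
have one0 : inZp 1 != 0 :> I.
  by rewrite -val_eqE /= modn_small // ltnS (leq_trans _ hl).
have two0 : inZp 1 + inZp 1 != 0 :> I.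
  by rewrite -val_eqE /= (modn_small (m := 1)) ?modn_small ?ltnS // (leq_trans _ hl).
have ip : (i == i ⊕ 1) = false.
  by apply/negbTE; rewrite -{1}(addr0 i) (inj_eq (addrI i)) eq_sym.
have im : (i == i ⊖ 1) = false.
  by apply/negbTE; rewrite -{1}(addr0 i) (inj_eq (addrI i)) eq_sym oppr_eq0.
have mp : (i ⊖ 1 == i ⊕ 1) = false.
  apply/negbTE; rewrite (inj_eq (addrI i)) -subr_eq0 -opprD oppr_eq0.
  exact: two0.
have f0 : f i != 0.
  by rewrite tofrac_eq0; apply/eqP => /(congr1 (mcoeff U_(rshift l.+1 i)%MM)) /eqP;
    rewrite mcoeffX eqxx mcoeff0 oner_eq0.
have vX j : mmap (@rconst _ _) v 'X_j = v j by rewrite mmapX mmap1U.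
have va j : v (lshift _ j) = s_alpha i j by exact: on_gens_alpha.
have vf j : v (rshift _ j) = s_f i j by exact: on_gens_f.
have vfi : v (rshift _ i) = f i by rewrite vf /s_f ip im.
have vai : v (lshift _ i) = - alpha i by rewrite va /s_alpha eqxx.
split; first by rewrite -(tofrac_eq0 'X_ _).
  by rewrite vX vfi.
elim/gens_ind => j.
  exists 0%N; rewrite va /s_alpha; case: (eqVneq j i) => [->|ji].
    exists (- 'X_(lshift _ i)); rewrite mmapN vX vai opprK.
    by rewrite expr0 !mulr1 tofracN.
  case: ifP => jn.
    exists ('X_(lshift _ j) + 'X_(lshift _ i)); rewrite mmapD !vX va vai.
    by rewrite /s_alpha (negbTE ji) jn expr0 !mulr1 tofracD addrK.
  exists 'X_(lshift _ j); rewrite vX va /s_alpha (negbTE ji) jn.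
  by rewrite expr0 !mulr1.
rewrite vf /s_f; case: (eqVneq j (i ⊕ 1)) => [->|jp].
  exists 1%N, ('X_(rshift _ (i ⊕ 1)) * 'X_(rshift _ i) + 'X_(lshift _ i)).
  rewrite mmapD rmorphM /= !vX vfi vai vf /s_f eqxx expr1.
  rewrite tofracD tofracM -/(f _) -/(f i) -/(alpha i) !mulrDl divfK //.
  by rewrite addrK.
case: (eqVneq j (i ⊖ 1)) => [->|jm].
  exists 1%N, ('X_(rshift _ (i ⊖ 1)) * 'X_(rshift _ i) - 'X_(lshift _ i)).
  rewrite mmapB rmorphM /= !vX vfi vai vf /s_f mp eqxx expr1.
  rewrite tofracB tofracM -/(f _) -/(f i) -/(alpha i) !mulrBl divfK //.
  by rewrite opprK subrK.
exists 0%N, 'X_(rshift _ j); rewrite vX vf /s_f (negbTE jp) (negbTE jm).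
by rewrite expr0 !mulr1.
Qed.

Lemma s_automorphism i : (2 <= l)%N -> automorphism_over (s i).
Proof. by move=> hl; apply: rsubst_over; apply: s_inverts. Qed.

Lemma s_alphaE i j : (2 <= l)%N -> s i (alpha j) = s_alpha i j.
Proof. by move=> hl; rewrite [LHS](rsubst_X _ (s_inverts i hl)) on_gens_alpha. Qed.

Lemma s_fE i j : (2 <= l)%N -> s i (f j) = s_f i j.
Proof. by move=> hl; rewrite [LHS](rsubst_X _ (s_inverts i hl)) on_gens_f. Qed.

Lemma shift_inverts (a b : I) : a + b = 0 ->
  inverts (on_gens (fun j => alpha (j + a)) (fun j => f (j + a)))
          (on_gens (fun j => alpha (j + b)) (fun j => f (j + b))) 1.
Proof.
move=> ab; split; [exact: oner_neq0 | by rewrite rmorph1 tofrac1 |].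
elim/gens_ind => j; exists 0%N.
  exists 'X_(lshift _ (j + a)); rewrite mmapX mmap1U !on_gens_alpha expr0 !mulr1.
  by rewrite -addrA ab addr0.
exists 'X_(rshift _ (j + a)); rewrite mmapX mmap1U !on_gens_f expr0 !mulr1.
by rewrite -addrA ab addr0.
Qed.

Lemma pi_automorphism : automorphism_over pi.
Proof.
apply: rsubst_over; apply: shift_inverts.
  exact: subrr.
exact: addNr.
Qed.

Lemma pi_alpha j : pi (alpha j) = alpha (j ⊕ 1).
Proof.
by rewrite [LHS](rsubst_X _ (shift_inverts (subrr _))) on_gens_alpha.
Qed.

Lemma pi_f j : pi (f j) = f (j ⊕ 1).
Proof.
by rewrite [LHS](rsubst_X _ (shift_inverts (subrr _))) on_gens_f.
Qed.

End Action.

Arguments alpha : clear implicits.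
Arguments f : clear implicits.
Arguments D : clear implicits.
Arguments ext_affine_weyl : clear implicits.

(* Main.v *)
From HB Require Import structures.
Require Import Defs.
From mathcomp Require Import all_boot all_order all_algebra.
From mathcomp Require Import fraction complex mpoly reals.
From mathcomp Require Import ring zify.

Set Implicit Arguments.
Unset Strict Implicit.
Unset Printing Implicit Defensive.

Import GRing.Theory.
Local Open Scope ring_scope.

(** Both composites [w \o '] and [' \o w] are additive and satisfy the Leibniz
rule along the field automorphism [w], so the elements on which they agree form
a subfield ([commute_on_generators]). Commuting with ['] is moreover stable
under composition and inversion, so it is enough to compare the composites on
the variables, for the generators [s_i] and [pi] of the group. For [pi] this is the
cyclic symmetry of the formulas.

For [s_i], number the indices from [i], writing [p] for [i + p], and put
[a = alpha_0 / f_0]. In both parities the vector field can be written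
<<
  f_p' = f_p H_p + alpha_p E_p
>>
where [E] is fixed by [s_i] and depends only on the parity of [p], and where
<<
  H_p + H_(p+1) = f_(p+1) E_p - f_p E_(p+1).
>>
For [l = 2n] one takes [E_p = 1] and [H_p] the alternating sum of
[f_(p+1), ..., f_(p+2n)]. For [l = 2n+1] one takes
[E_p = f_p + f_(p+2) + ... + f_(p+2n)] and
[H_p = G_p + k/2 - (alpha_p + alpha_(p+2) + ... + alpha_(p+2n))], where [G_p] is
the quadratic sum of the equation; adding [f_p alpha_p] to one term of the
equation and removing it from another completes the two partial sums to full
ones.

The two-term relation is the heart of the matter. As [s_i] only moves [f_1] (by
[+ a]) and [f_l] (by [- a]), applying [s_i] to the relation determines all
variations [s_i H_p - H_p] from the one at [p = 0]: if that one is [2 a E_0],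
then those at [p = 1] and [p = l] are [- a E_0] and the others vanish. The same
relation, at [p = 0] and [p = l], is then exactly what is needed to compare
[s_i (f_p')] with [(s_i f_p)'] at the neighbours of [i]
([reflection_commutes]). So for each parity only three computations remain: the
relation itself, the invariance of [E], and the variation of [H_0]. All are
statements about sums over arithmetic progressions of step two. *)

(** * Sums along progressions of step two *)

Section Sequences.
Context (A : comPzRingType).
Implicit Types (x y : nat -> A).

Definition stride_sum x p m : A := \sum_(r < m) x (p + r.*2)%N.

(** The double sum of the odd case, over pairs of opposite parity with sign given
by the first index, grouped by the larger index so that it can be treated by
induction on [n]; [quad_sumE] recovers the triangular form. *)
Definition quad_sum x p n : A :=
  \sum_(s < n) (stride_sum x p.+1 s.+1 * x (p + s.*2.+2)%N
                - stride_sum x p.+2 s.+1 * x (p + s.*2.+3)%N).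

Lemma stride_sum_recr x p m :
  stride_sum x p m.+1 = stride_sum x p m + x (p + m.*2)%N.
Proof. by rewrite /stride_sum big_ord_recr. Qed.

Lemma stride_sum_recl x p m :
  stride_sum x p m.+1 = x p + stride_sum x p.+2 m.
Proof.
rewrite /stride_sum big_ord_recl addn0; congr (_ + _).
by apply: eq_bigr => r _; congr x; rewrite lift0; lia.
Qed.

Lemma stride_sum_period x p m : x (p + m.*2)%N = x p ->
  stride_sum x p.+2 m = stride_sum x p m.
Proof.
move=> xp; apply: (addrI (x p)).
by rewrite -stride_sum_recl stride_sum_recr xp addrC.
Qed.

Lemma stride_sum_odd_even x p m :
  stride_sum x p m + stride_sum x p.+1 m = \sum_(q < m.*2) x (p + q)%N.
Proof.
elim: m => [|m IH]; first by rewrite /stride_sum !big_ord0 addr0.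
rewrite doubleS !big_ord_recr /= -IH !stride_sum_recr addSn addnS.
by rewrite addrACA addrA.
Qed.

Lemma stride_sum_eq x y p m :
  (forall r, (r < m)%N -> x (p + r.*2)%N = y (p + r.*2)%N) ->
  stride_sum x p m = stride_sum y p m.
Proof. by move=> xy; apply: eq_bigr => r _; apply: xy. Qed.

(** The products common to both sums occur in them with opposite signs, so only
those involving an extreme index, [p + 1] or [p + 2n + 2], survive: this is the
relation between [H_p] and [H_(p+1)] before periodicity is used. *)
Lemma quad_sum_shift x p n :
  quad_sum x p n + quad_sum x p.+1 n =
  x p.+1 * stride_sum x p.+2 n.+1 - stride_sum x p.+1 n.+1 * x (p + n.*2.+2)%N.
Proof.
elim: n => [|n IH].
  by rewrite /quad_sum !big_ord0 /stride_sum !big_ord1 !addn0 addn2; ring.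
rewrite /quad_sum !(big_ord_recr n) -/(quad_sum x p n) -/(quad_sum x p.+1 n) /=.
rewrite (stride_sum_recr x p.+2 n.+1).
have e : stride_sum x p.+1 n.+2 = x p.+1 + stride_sum x p.+3 n.+1.
  exact: stride_sum_recl.
have e1 : (p.+1 + n.*2.+2 = p + n.*2.+3)%N by lia.
have e2 : (p.+1 + n.*2.+3 = p + n.*2.+4)%N by lia.
have e3 : (p.+2 + n.+1.*2 = p + n.*2.+4)%N by lia.
rewrite addrACA {}IH e e1 e2 e3 doubleS.
have e4 : stride_sum x p.+1 n.+1 + x (p + n.*2.+3)%N
    = x p.+1 + stride_sum x p.+3 n.+1.
  by rewrite -e (stride_sum_recr x p.+1 n.+1); congr (_ + x _); lia.
ring.
Qed.

Lemma triangle_sum (g : nat -> nat -> A) n :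
  \sum_(1 <= r < n.+1) \sum_(r <= s < n.+1) g r s =
  \sum_(s < n) \sum_(r < s.+1) g r.+1 s.+1.
Proof.
elim: n => [|n IH]; first by rewrite big_nil big_ord0.
rewrite big_ord_recr -IH [LHS]big_nat_recr //= big_nat1.
rewrite (eq_big_nat _ _ (F2 := fun r => \sum_(r <= s < n.+1) g r s + g r n.+1)).
  rewrite big_split /= -addrA; congr (_ + _).
  by rewrite -(big_nat_recr _ _ (fun r => g r n.+1)) //= big_add1 big_mkord.
by move=> r /andP[_ rn]; rewrite big_nat_recr // ltnW.
Qed.

Lemma quad_sumE x p n :
  \sum_(1 <= r < n.+1) \sum_(r <= s < n.+1)
     x (p + (2 * r - 1))%N * x (p + 2 * s)%N
  - \sum_(1 <= r < n.+1) \sum_(r <= s < n.+1)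
     x (p + 2 * r)%N * x (p + (2 * s + 1))%N = quad_sum x p n.
Proof.
rewrite !triangle_sum -sumrB; apply: eq_bigr => s _.
rewrite -!mulr_suml; congr (_ * _ - _ * _); try by congr x; lia.
  by apply: eq_bigr => r _; congr x; lia.
by apply: eq_bigr => r _; congr x; lia.
Qed.

Lemma stride_sum_evens x p n :
  \sum_(1 <= r < n.+1) x (p + 2 * r)%N = stride_sum x p.+2 n.
Proof.
by rewrite big_add1 big_mkord /=; apply: eq_bigr => r _; congr x; lia.
Qed.

Lemma stride_sum_odds x p n :
  \sum_(1 <= r < n.+1) x (p + (2 * r - 1))%N = stride_sum x p.+1 n.
Proof.
by rewrite big_add1 big_mkord /=; apply: eq_bigr => r _; congr x; lia.
Qed.

(** The two moved entries, at [1] and [2n + 1], have indices of the same parity and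
never occur in the same product, so the variation is linear in [a]. As both
indices are extreme, each entry is multiplied by all the entries of even index
[2, ..., 2n], with sign [+] for the first, which increases by [a], and [-] for
the last, which decreases by [a]. *)
Lemma quad_sum_perturb x y a n : (0 < n)%N ->
  y 1%N = x 1%N + a -> y n.*2.+1 = x n.*2.+1 - a ->
  (forall p, (1 < p)%N -> (p < n.*2.+1)%N -> y p = x p) ->
  quad_sum y 0 n = quad_sum x 0 n + a * stride_sum x 2 n *+ 2.
Proof.
case: n => // n _ y1; rewrite doubleS => yl yeq.
have To s : (s < n.+1)%N -> stride_sum y 1 s.+1 = stride_sum x 1 s.+1 + a.
  move=> sn; rewrite !stride_sum_recl y1 addrAC.
  by congr (_ + _ + _); apply: stride_sum_eq => r rs; apply: yeq; lia.
have Te s : (s < n.+1)%N -> stride_sum y 2 s.+1 = stride_sum x 2 s.+1.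
  by move=> sn; apply: stride_sum_eq => r rs; apply: yeq; lia.
have e2 : stride_sum x 2 n.+1 = stride_sum x 2 n + x n.*2.+2.
  by rewrite stride_sum_recr; congr (_ + x _); lia.
rewrite /quad_sum !big_ord_recr /= !add0n yl To // Te // [y n.*2.+2]yeq; try lia.
rewrite (eq_bigr (fun s : 'I_n => (stride_sum x 1 s.+1 * x (0 + s.*2.+2)%N
   - stride_sum x 2 s.+1 * x (0 + s.*2.+3)%N) + a * x (2 + s.*2)%N)).
  by rewrite big_split -mulr_sumr -/(stride_sum x 2 n) e2 /=; ring.
move=> s _; have sn := ltn_ord s.
rewrite To ?Te ?[y _]yeq ?[y (_ + _.+3)%N]yeq; try lia.
by rewrite !add0n !add2n; ring.
Qed.

Lemma stride_sum_perturb_odd x y b c n : (0 < n)%N ->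
  y 1%N = x 1%N + b -> y n.*2.+1 = x n.*2.+1 + c ->
  (forall p, (1 < p)%N -> (p < n.*2.+1)%N -> y p = x p) ->
  stride_sum y 1 n.+1 = stride_sum x 1 n.+1 + (b + c).
Proof.
case: n => // n _ y1 yl yeq.
rewrite !(stride_sum_recr _ _ n.+1) !(stride_sum_recl _ _ n).
rewrite y1 add1n yl (@stride_sum_eq y x) => [|r rn]; last by apply: yeq; lia.
by ring.
Qed.

(** Here the two moved entries have opposite signs in the sum and opposite
increments, whence the factor two. *)
Lemma alternating_sum_perturb x y a n : (0 < n)%N ->
  y 1%N = x 1%N + a -> y n.*2 = x n.*2 - a ->
  (forall p, (1 < p)%N -> (p < n.*2)%N -> y p = x p) ->
  stride_sum y 1 n - stride_sum y 2 n =
  stride_sum x 1 n - stride_sum x 2 n + a *+ 2.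
Proof.
case: n => // n _ y1 yl yeq; rewrite [stride_sum y 1 _]stride_sum_recl.
rewrite [stride_sum x 1 _]stride_sum_recl !(stride_sum_recr _ _ n) y1.
rewrite add2n yl (@stride_sum_eq y x 3) => [|r rn]; last by apply: yeq; lia.
by rewrite (@stride_sum_eq y x 2) => [|r rn]; [ring | apply: yeq; lia].
Qed.

Lemma alternating_sum_shift x p n :
  (stride_sum x p.+1 n - stride_sum x p.+2 n)
    + (stride_sum x p.+2 n - stride_sum x p.+3 n) =
  x p.+1 - x (p.+1 + n.*2)%N.
Proof.
rewrite addrA subrK; apply/eqP; rewrite subr_eq addrAC eq_sym subr_eq.
by rewrite -stride_sum_recr -stride_sum_recl.
Qed.

Lemma stride_sum_shift_period x N p m : (forall q, x (N + q)%N = x q) ->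
  stride_sum x (N + p) m = stride_sum x p m.
Proof. by move=> xN; apply: eq_bigr => r _; rewrite -addnA xN. Qed.

Lemma quad_sum_shift_period x N p n : (forall q, x (N + q)%N = x q) ->
  quad_sum x (N + p) n = quad_sum x p n.
Proof.
move=> xN; apply: eq_bigr => s _; rewrite -!addnS -!addnA !xN.
by rewrite !stride_sum_shift_period.
Qed.

End Sequences.

Lemma rmorph_stride_sum (A B : comPzRingType) (g : {rmorphism A -> B}) x p m :
  g (stride_sum x p m) = stride_sum (g \o x) p m.
Proof. exact: rmorph_sum. Qed.

Lemma rmorph_quad_sum (A B : comPzRingType) (g : {rmorphism A -> B}) x p n :
  g (quad_sum x p n) = quad_sum (g \o x) p n.
Proof.
rewrite rmorph_sum; apply: eq_bigr => s _.
by rewrite rmorphB !rmorphM !rmorph_stride_sum.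
Qed.

(** * Vector fields compatible with a reflection *)

Section Reflection.
Context (F : fieldType) (sigma : {rmorphism F -> F}) (D : F -> F) (l : nat).
Context (f alpha H E : nat -> F).
Local Notation a := (alpha 0%N / f 0%N).
Context (l_gt1 : (1 < l)%N).
Context (DD : forall x y, D (x + y) = D x + D y).
Context (DM : forall x y, D (x * y) = D x * y + x * D y).
Context (f0_neq0 : f 0%N != 0).
Context (D_alpha0 : D (alpha 0%N) = 0).
Context (D_f : forall p, D (f p) = f p * H p + alpha p * E p).
Context (H_rec : forall p, H p + H p.+1 = f p.+1 * E p - f p * E p.+1).
Context (E_rec : forall p, E p.+2 = E p).
Context (f_per : f l.+1 = f 0%N).
Context (H_per : H l.+1 = H 0%N) (E_per : E l.+1 = E 0%N).
Context (sE : forall p, sigma (E p) = E p).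
Context (sf0 : sigma (f 0%N) = f 0%N).
Context (sf1 : sigma (f 1%N) = f 1%N + a).
Context (sfl : sigma (f l) = f l - a).
Context (sfm : forall p, (1 < p)%N -> (p < l)%N -> sigma (f p) = f p).
Context (sa0 : sigma (alpha 0%N) = - alpha 0%N).
Context (sa1 : sigma (alpha 1%N) = alpha 1%N + alpha 0%N).
Context (sal : sigma (alpha l) = alpha l + alpha 0%N).
Context (sam : forall p, (1 < p)%N -> (p < l)%N -> sigma (alpha p) = alpha p).
Context (sH0 : sigma (H 0%N) = H 0%N + a * E 0%N *+ 2).

(** From here on, [H_rec] and its image under [sigma] propagate the variation of
[H 0] to all the [H p]. *)
Let sH_rec p :
  sigma (H p) + sigma (H p.+1) =
  sigma (f p.+1) * E p - sigma (f p) * E p.+1.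
Proof. by rewrite -rmorphD H_rec rmorphB !rmorphM !sE. Qed.

Let sH1 : sigma (H 1%N) = H 1%N - a * E 0%N.
Proof.
apply: (addrI (sigma (H 0%N))); rewrite sH_rec sf0 sf1 sH0.
have := H_rec 0; move: (a) => b e.
(* The middle expression displays the right-hand side of [H_rec 0]. *)
transitivity (f 1%N * E 0%N - f 0%N * E 1%N + b * E 0%N); first by ring.
by rewrite -e; ring.
Qed.

Let sHl : sigma (H l) = H l - a * E 0%N.
Proof.
apply: (addIr (sigma (H l.+1))); rewrite sH_rec f_per sf0 sfl H_per sH0 E_per.
have := H_rec l; rewrite f_per H_per E_per; move: (a) => b e.
transitivity (f 0%N * E l - f l * E 0%N + b * E 0%N); first by ring.
by rewrite -e; ring.
Qed.

Let sHm p : (1 < p)%N -> (p < l)%N -> sigma (H p) = H p.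
Proof.
elim: p => // -[//|[|p] IH] _ pl.
  apply: (addrI (sigma (H 1%N))); rewrite sH_rec sf1 sfm // sH1 E_rec.
  have := H_rec 1; rewrite E_rec; move: (a) => b e.
  transitivity (f 2%N * E 1%N - f 1%N * E 0%N - b * E 0%N); first by ring.
  by rewrite -e; ring.
apply: (addrI (sigma (H p.+2))).
by rewrite sH_rec (IH _ (ltnW pl)) // !sfm ?(ltnW pl).
Qed.

Let D_a : D a = - (a * H 0%N + a ^+ 2 * E 0%N).
Proof.
have := DM a (f 0%N); have a0 : alpha 0%N = a * f 0%N by rewrite divfK.
rewrite -{1}a0 D_alpha0 D_f.
move: (a) (D _) a0 => b Db -> e.
apply: (mulIf f0_neq0); apply: (addIr (b * (f 0%N * H 0%N + b * f 0%N * E 0%N))).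
by rewrite -e; ring.
Qed.

Let D_opp_a : D (- a) = - D a.
Proof.
have D0 : D 0 = 0 by apply: (addrI (D 0)); rewrite -DD !addr0.
by apply: (addrI (D a)); rewrite -DD !subrr.
Qed.

(** The neighbours of [0] are [1] and [l]. There the images under [sigma] bring in
[H 1 * a] (or [H l * a]), and the derivative of [a = alpha 0 / f 0] brings in
[H 0 * a]; their sum is evaluated by [H_rec]. At [0] the variation
[2 * a * E 0] of [H 0], multiplied by [f 0], compensates the change of sign of [alpha 0]. *)
Lemma reflection_commutes p : (p <= l)%N -> sigma (D (f p)) = D (sigma (f p)).
Proof.
move=> pl; have a0 : alpha 0%N = a * f 0%N by rewrite divfK.
rewrite D_f rmorphD !rmorphM sE.
case: p pl => [|[|p]] pl.
- by rewrite sf0 sa0 sH0 D_f a0 (mulfK f0_neq0); ring.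
- rewrite sf1 sH1 sa1 DD D_f D_a.
  have := H_rec 0; move: (a) a0 => b -> e.
  transitivity (f 1%N * H 1%N + alpha 1%N * E 1%N + b * H 1%N
    - b * (f 1%N * E 0%N - f 0%N * E 1%N) - b ^+ 2 * E 0%N); first by ring.
  by rewrite -e; ring.
move: pl; rewrite leq_eqVlt => /predU1P[->|pl]; last first.
  by rewrite sfm // sHm // sam // D_f.
rewrite sfl sHl sal DD D_opp_a D_f D_a.
have := H_rec l; rewrite f_per H_per E_per; move: (a) a0 => b -> e.
transitivity (f l * H l + alpha l * E l - b * H l
    + b * (f 0%N * E l - f l * E 0%N) + b ^+ 2 * E 0%N); first by ring.
by rewrite -e; ring.
Qed.
End Reflection.

(** * Unrolling the cycle of indices *)

Lemma inZpD l p q : inZp p + inZp q = inZp (p + q) :> 'I_l.+1.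
Proof. by apply: val_inj; rewrite /= modnDm. Qed.

Lemma inZp_val l (j : 'I_l.+1) : inZp j = j.
Proof. by apply: val_inj; rewrite /= modn_small. Qed.

Section Cyclic.
Context (l : nat) (T : Type).
Implicit Types (g : 'I_l.+1 -> T) (i : 'I_l.+1).

(** Numbering the cycle from [i] turns functions on the cyclic index set into
periodic sequences, to which the sums above apply; offsets become additions of
natural numbers. *)
Definition unroll g i p : T := g (i + inZp p).

Lemma unrollD g i p q : g (i + inZp p + inZp q) = unroll g i (p + q).
Proof. by rewrite /unroll -addrA inZpD. Qed.

Lemma unroll_period g i p : unroll g i (l.+1 + p) = unroll g i p.
Proof.
rewrite /unroll -inZpD (_ : inZp l.+1 = 0) ?add0r //.
by apply: val_inj; rewrite /= modnn.
Qed.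

Lemma unroll_surj i j : exists2 p, (p <= l)%N & j = i + inZp p.
Proof.
exists (val (j - i)); first exact: (ltn_ord (j - i)).
by rewrite inZp_val addrC subrK.
Qed.

Lemma unroll_eq i p q : (p <= l)%N -> (q <= l)%N ->
  (i + inZp p == i + inZp q) = (p == q).
Proof.
by move=> pl ql; rewrite (inj_eq (addrI i)) -val_eqE /= !modn_small.
Qed.

End Cyclic.

Lemma sum_unroll l (A : zmodType) (g : 'I_l.+1 -> A) i p :
  \sum_(q < l.+1) unroll g i (p + q) = \sum_j g j.
Proof.
rewrite [RHS](reindex (fun q : 'I_l.+1 => i + inZp p + q)) /=; last first.
  by apply: onW_bij; exists (fun q => q - (i + inZp p)) => q;
    rewrite addrC ?subrK // addKr.
by apply: eq_bigr => q _; rewrite -unrollD inZp_val.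
Qed.

(** * Automorphisms and derivations of rational function fields *)

Section RationalFunctions.
Context (F : fieldType) (n : nat).
Local Notation K := (ratfun F n).
Local Notation "p %:F" := (@FracField.tofrac {mpoly F[n]} p).

(** Stated as an equation between functions, to be rewritten in both directions
around a use of the morphism lemmas. *)
Lemma automorphism_over_rmorphism (sigma : K -> K) :
  automorphism_over sigma -> exists tau : {rmorphism K -> K}, sigma = tau.
Proof.
case=> zm mm _ _.
by exists (HB.pack sigma (GRing.isZmodMorphism.Build _ _ _ zm)
  (GRing.isMonoidMorphism.Build _ _ _ mm) : {rmorphism K -> K}).
Qed.

Lemma derivationD (D : K -> K) : derivation_over D -> {morph D : x y / x + y}.
Proof. by case=> Dlin _ x y; have := Dlin 1 x y; rewrite rmorph1 !mul1r. Qed.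

Lemma derivation0 (D : K -> K) : derivation_over D -> D 0 = 0.
Proof. by move=> DD; apply: (addrI (D 0)); rewrite -(derivationD DD) !addr0. Qed.

Lemma derivationN (D : K -> K) : derivation_over D -> {morph D : x / - x}.
Proof.
move=> DD x; apply: (addrI (D x)).
by rewrite -(derivationD DD) !subrr (derivation0 DD).
Qed.

Lemma derivation_const (D : K -> K) c : derivation_over D -> D (rconst n c) = 0.
Proof.
move=> DD; have D1 : D 1 = 0.
  apply: (addrI (D 1)); rewrite addr0 -[in RHS](mul1r 1).
  by case: DD => _ ->; rewrite mul1r mulr1.
have := DD.1 c 1 0.
by rewrite mulr1 addr0 D1 (derivation0 DD) mulr0 addr0.
Qed.

(** The two composites agree on a subring containing constants and variables,
hence on polynomials. For a quotient [y = p / q], the Leibniz rule applied to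
[y * q = p] determines both of them at [y] from their values at [p] and [q]. *)
Lemma commute_on_generators (sigma D : K -> K) :
  automorphism_over sigma -> derivation_over D ->
  (forall v, sigma (D ('X_v)%:F) = D (sigma ('X_v)%:F)) ->
  forall x, sigma (D x) = D (sigma x).
Proof.
move=> autS derD; have [_ _ sigmaC _] := autS.
have [tau etau] := automorphism_over_rmorphism autS; move: sigmaC; rewrite etau.
move=> tauC tauX; have D_add := derivationD derD; have D_mul := derD.2.
pose Q x := tau (D x) = D (tau x).
have QM x y : Q x -> Q y -> Q (x * y).
  by rewrite /Q => ex ey; rewrite D_mul !rmorphD !rmorphM D_mul ex ey.
have QC c : Q (rconst n c) by rewrite /Q tauC (derivation_const c derD) rmorph0.
have Qpoly p : Q p%:F.
  elim/mpolyind: p => [|c m p _ _ IH].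
    by rewrite tofrac0 /Q rmorph0 (derivation0 derD) rmorph0.
  rewrite tofracD /Q D_add !rmorphD D_add IH; congr (_ + _).
  rewrite -mul_mpolyC tofracM; apply: (QM); first exact: QC.
  have Q1 : Q 1 by have := QC 1; rewrite rmorph1.
  rewrite mpolyXE_id rmorph_prod; apply: (big_ind Q).
  - exact: Q1.
  - exact: QM.
  move=> v _; rewrite /= tofracXn; elim: (m v) => [|k IHk]; first by rewrite expr0.
  by rewrite exprS; apply: QM => //; apply: tauX.
move=> x; have [p [q [q0 ->]]] := Defs.ratP x; set y := _ / _.
have q0' : q%:F != 0 by rewrite tofrac_eq0.
have yq : y * q%:F = p%:F by rewrite divfK.
(* The value of [y] is forgotten, to keep [rmorphM] from distributing over it. *)
move: y yq => y yq.
apply: (mulIf (x := tau q%:F)); first by rewrite fmorph_eq0.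
apply: (addIr (tau y * tau (D q%:F))).
transitivity (tau (D p%:F)); first by rewrite -yq D_mul rmorphD !rmorphM.
by rewrite Qpoly -yq rmorphM D_mul -(Qpoly q).
Qed.

End RationalFunctions.

(** * The rotation and the reflections *)

(** Moving [u * v] from the last term to the first completes the partial sums [c]
and [t] by their missing terms [v] and [u]. *)
Lemma odd_factor (A : comPzRingType) (u v g h c t : A) :
  u * g + (h - c) * u + v * t = u * (g + (h - (v + c))) + v * (u + t).
Proof. by ring. Qed.

Section VectorField.
Context (R : realType) (l : nat).
Local Notation I := 'I_l.+1.
Local Notation K := (ratfun R[i] (l.+1 + l.+1)).
Implicit Types (i j : I).

Lemma f'_evenE n i p (x := unroll (f R l) i) :
  f'_even R n (i + inZp p) =
  x p * (stride_sum x p.+1 n - stride_sum x p.+2 n) + alpha R l (i + inZp p).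
Proof.
rewrite /f'_even -stride_sum_odds -stride_sum_evens.
by congr (_ * (_ - _) + _); apply: eq_bigr => r _; rewrite unrollD.
Qed.

Lemma f'_oddE n i p (x := unroll (f R l) i) (y := unroll (alpha R l) i) :
  f'_odd R n (i + inZp p) =
  x p * (quad_sum x p n + (ksum R l / 2 - stride_sum y p n.+1))
  + y p * stride_sum x p n.+1.
Proof.
rewrite !stride_sum_recl -odd_factor -quad_sumE -!stride_sum_evens /f'_odd.
congr (_ * (_ - _) + (_ - _) * _ + _ * _); apply: eq_bigr => r _;
  by [rewrite unrollD | apply: eq_bigr => q _; rewrite !unrollD].
Qed.

Lemma D_alphaN j : D R l (- alpha R l j) = 0.
Proof. by rewrite (derivationN (D_derivation R l)) D_alpha oppr0. Qed.

Lemma pi_commutes (phi : K) : @Defs.pi R l (D R l phi) = D R l (Defs.pi phi).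
Proof.
apply: commute_on_generators; [exact: pi_automorphism|exact: D_derivation|].
have [tau etau] := automorphism_over_rmorphism (pi_automorphism R l).
have tau_alpha j : tau (alpha R l j) = alpha R l (j + inZp 1).
  by rewrite -etau pi_alpha.
have tau_f j : tau (f R l j) = f R l (j + inZp 1).
  by rewrite -etau pi_f.
have tau_ksum : tau (ksum R l) = ksum R l.
  rewrite rmorph_sum /ksum [RHS](reindex_inj (addIr (inZp 1))).
  by apply: eq_bigr => j _; apply: tau_alpha.
have tau_f_at j q : tau (f R l (j + inZp q)) = f R l (j + inZp 1 + inZp q).
  by rewrite tau_f addrAC.
apply: gens_ind => j.
  rewrite -[tofrac _]/(alpha R l j) D_alpha pi_alpha D_alpha etau.
  exact: rmorph0.
rewrite -[tofrac _]/(f R l j) D_f pi_f D_f etau /f'; case: ifP => _.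
  rewrite /f'_odd !rmorphD !rmorphM !rmorphB !rmorph_sum fmorph_div rmorph_nat.
  rewrite tau_ksum tau_f tau_alpha.
  congr (_ * (_ - _) + (_ - _) * _ + _ * _); apply: eq_bigr => r _.
  - by rewrite rmorph_sum; apply: eq_bigr => q _; rewrite rmorphM !tau_f_at.
  - by rewrite rmorph_sum; apply: eq_bigr => q _; rewrite rmorphM !tau_f_at.
  - by rewrite /= tau_alpha addrAC.
  - exact: tau_f_at.
rewrite /f'_even rmorphD rmorphM rmorphB !rmorph_sum tau_f tau_alpha.
by congr (_ * (_ - _) + _); apply: eq_bigr => r _; apply: tau_f_at.
Qed.

Section SimpleReflection.
Context (i : I) (l_ge2 : (2 <= l)%N).
Local Notation x := (unroll (f R l) i).
Local Notation y := (unroll (alpha R l) i).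
Local Notation a := (y 0%N / x 0%N).

Let i0 : i + inZp 0 = i.
Proof. by rewrite (_ : inZp 0 = 0) ?addr0 //; apply: val_inj. Qed.

Let il : i - inZp 1 = i + inZp l.
Proof.
apply: (addIr (inZp 1)); rewrite subrK -addrA inZpD addn1 -[inZp _]/(inZp (l.+1)).
by rewrite -[LHS]i0; congr (_ + _); apply: val_inj; rewrite /= modnn.
Qed.

Let s_x p : (p <= l)%N ->
  s i (x p) = if p == 1%N then x p + a else if p == l then x p - a else x p.
Proof.
move=> pl; rewrite s_fE // /s_f il !unroll_eq //; last exact: ltnW.
by rewrite /unroll i0.
Qed.

Let s_y p : (p <= l)%N ->
  s i (y p) = if p == 0%N then - y p
              else if (p == 1%N) || (p == l) then y p + y 0%N else y p.
Proof.
move=> pl; have e0 := unroll_eq i pl (leq0n l); rewrite i0 in e0.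
rewrite s_alphaE // /s_alpha il e0 !unroll_eq //; last exact: ltnW.
by case: eqP => [->|_]; rewrite /unroll i0.
Qed.

Let l1 : (l == 1)%N = false. Proof. by lia. Qed.
Let l0 : (l == 0)%N = false. Proof. by lia. Qed.

Lemma s_x0 : s i (x 0%N) = x 0%N.
Proof. by rewrite s_x // [_ == l]eq_sym l0. Qed.

Lemma s_x1 : s i (x 1%N) = x 1%N + a.
Proof. by rewrite s_x // ltnW. Qed.

Lemma s_xl : s i (x l) = x l - a.
Proof. by rewrite s_x // l1 eqxx. Qed.

Lemma s_xm p : (1 < p)%N -> (p < l)%N -> s i (x p) = x p.
Proof. by move=> p1 pl; rewrite s_x ?(ltnW pl) // gtn_eqF // ltn_eqF. Qed.

Lemma s_y0 : s i (y 0%N) = - y 0%N.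
Proof. by rewrite s_y. Qed.

Lemma s_y1 : s i (y 1%N) = y 1%N + y 0%N.
Proof. by rewrite s_y // ltnW. Qed.

Lemma s_yl : s i (y l) = y l + y 0%N.
Proof. by rewrite s_y // l0 eqxx orbT. Qed.

Lemma s_ym p : (1 < p)%N -> (p < l)%N -> s i (y p) = y p.
Proof.
move=> p1 pl; rewrite s_y ?(ltnW pl) // (gtn_eqF p1) (ltn_eqF pl).
by rewrite gtn_eqF // ltnW.
Qed.

Let D_add := derivationD (D_derivation R l).

Lemma s_commutes_alpha j : s i (D R l (alpha R l j)) = D R l (s i (alpha R l j)).
Proof.
have [tau etau] := automorphism_over_rmorphism (s_automorphism R i l_ge2).
rewrite D_alpha s_alphaE // /s_alpha etau rmorph0.
case: ifP => _; first by rewrite D_alphaN.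
by case: ifP => _; rewrite ?D_add !D_alpha ?addr0.
Qed.

Lemma x0_neq0 : x 0%N != 0.
Proof.
rewrite tofrac_eq0; set v := rshift _ _.
apply/eqP => /(congr1 (mcoeff U_(v)%MM))/eqP.
by rewrite mcoeffX eqxx mcoeff0 oner_eq0.
Qed.

(** Everything that [reflection_commutes] needs about the action of [s i] on the
variables; what depends on the parity of [l] is the choice of [H] and [E]. *)
Lemma s_commutes_f (H E : nat -> K) :
  (forall p, f' R (i + inZp p) = x p * H p + y p * E p) ->
  (forall p, H p + H p.+1 = x p.+1 * E p - x p * E p.+1) ->
  (forall p, E p.+2 = E p) ->
  H l.+1 = H 0%N -> E l.+1 = E 0%N ->
  (forall p, s i (E p) = E p) ->
  s i (H 0%N) = H 0%N + a * E 0%N *+ 2 ->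
  forall j, s i (D R l (f R l j)) = D R l (s i (f R l j)).
Proof.
move=> f'E H_rec E_rec H_per E_per sE sH0 j.
have [p pl ->] := unroll_surj i j; rewrite -/(x p).
have [tau etau] := automorphism_over_rmorphism (s_automorphism R i l_ge2).
move: sE sH0 s_x0 s_x1 s_xl s_xm s_y0 s_y1 s_yl s_ym; rewrite etau => *.
apply: (@reflection_commutes _ tau _ l x y H E) => //.
- exact: (D_derivation R l).2.
- exact: x0_neq0.
- exact: D_alpha.
- by move=> q; rewrite D_f f'E.
by have := unroll_period (f R l) i 0; rewrite addn0.
Qed.

Lemma s_commutes_f_even n j : l = n.*2 ->
  s i (D R l (f R l j)) = D R l (s i (f R l j)).
Proof.
move=> ln; have n_gt0 : (0 < n)%N by lia.
have odd_l : odd l = false by rewrite ln odd_double.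
have half_l : l./2 = n by rewrite ln doubleK.
have x_per := unroll_period (f R l) i.
have [tau etau] := automorphism_over_rmorphism (s_automorphism R i l_ge2).
pose H q := stride_sum x q.+1 n - stride_sum x q.+2 n.
apply: (@s_commutes_f H (fun=> 1)) => //.
- by move=> p; rewrite /f' odd_l half_l f'_evenE mulr1.
- move=> p; rewrite alternating_sum_shift !mulr1 -(x_per p).
  by congr (_ - x _); lia.
- have := stride_sum_shift_period 1 n x_per.
  have := stride_sum_shift_period 2 n x_per.
  by rewrite addn1 addn2 /H => -> ->.
- by move=> _; rewrite etau rmorph1.
rewrite mulr1 etau rmorphB !rmorph_stride_sum /= -etau.
apply: alternating_sum_perturb => // [||q q1 q2] /=.
- exact: s_x1.
- by rewrite -ln; exact: s_xl.
- by apply: s_xm; rewrite // ln.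
Qed.

Lemma s_commutes_f_odd n j : l = n.*2.+1 ->
  s i (D R l (f R l j)) = D R l (s i (f R l j)).
Proof.
move=> ln; have n_gt0 : (0 < n)%N by lia.
have odd_l : odd l = true by rewrite ln /= odd_double.
have half_l : l./2 = n by rewrite ln /= uphalf_double.
have x_per := unroll_period (f R l) i.
have y_per := unroll_period (alpha R l) i.
have size_period : l.+1 = n.+1.*2 by rewrite ln.
have ksumE p : ksum R l = stride_sum y p n.+1 + stride_sum y p.+1 n.+1.
  by rewrite stride_sum_odd_even -size_period sum_unroll.
have per2 (z : nat -> K) : (forall p, z (l.+1 + p)%N = z p) ->
    forall p, stride_sum z p.+2 n.+1 = stride_sum z p n.+1.
  by move=> zp p; apply: stride_sum_period; rewrite addnC -size_period.
have [tau etau] := automorphism_over_rmorphism (s_automorphism R i l_ge2).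
(* [s i] leaves [ksum] fixed, but moves its two halves by opposite amounts;
   the half through [i] enters [H 0]. *)
have sy_even : s i (stride_sum y 0 n.+1) = stride_sum y 0 n.+1 - y 0%N *+ 2.
  rewrite etau rmorph_stride_sum -etau !stride_sum_recl /= s_y0.
  rewrite (@stride_sum_eq _ (s i \o y) y) => [|r rn].
    by rewrite mulr2n; ring.
  by apply: s_ym; lia.
have sy_odd : s i (stride_sum y 1 n.+1) = stride_sum y 1 n.+1 + (y 0%N + y 0%N).
  rewrite etau rmorph_stride_sum -etau; apply: stride_sum_perturb_odd => //=.
  - exact: s_y1.
  - by rewrite -ln; exact: s_yl.
  - by rewrite -ln; exact: s_ym.
have s_ksum : s i (ksum R l) = ksum R l.
  by rewrite (ksumE 0%N) etau rmorphD -etau sy_even sy_odd; ring.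
have sx_even : s i (stride_sum x 0 n.+1) = stride_sum x 0 n.+1.
  rewrite etau rmorph_stride_sum -etau !stride_sum_recl /= s_x0.
  by rewrite (@stride_sum_eq _ (s i \o x) x) => // r rn; apply: s_xm; lia.
have sx_odd : s i (stride_sum x 1 n.+1) = stride_sum x 1 n.+1.
  rewrite -[RHS]addr0 -(subrr a) etau rmorph_stride_sum -etau.
  apply: stride_sum_perturb_odd => //=.
  - exact: s_x1.
  - by rewrite -ln; exact: s_xl.
  - by rewrite -ln; exact: s_xm.
have two_neq0 : 2 != 0 :> K.
  by rewrite -(rmorph_nat (@rconst R[i] _)) fmorph_eq0 Num.Theory.pnatr_eq0.
pose E p := stride_sum x p n.+1.
pose H p := quad_sum x p n + (ksum R l / 2 - stride_sum y p n.+1).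
apply: (@s_commutes_f H E).
- by move=> p; rewrite /f' odd_l half_l f'_oddE.
- move=> p; rewrite /H addrACA quad_sum_shift (addrACA (_ / 2)) -opprD -ksumE.
  rewrite -mulrDr -mulr2n -[_ *+ 2]mulr_natr mulVf // mulr1 subrr addr0.
  rewrite (per2 _ x_per) [_ * x _]mulrC -[x p in RHS](x_per p).
  by congr (_ - x _ * _); lia.
- exact: per2.
- have := stride_sum_shift_period 0 n.+1 y_per.
  have := quad_sum_shift_period 0 n x_per.
  by rewrite /H addn0 => -> ->.
- by have := stride_sum_shift_period 0 n.+1 x_per; rewrite /E addn0.
(* The sums [E 0] and [E 1] are invariant for different reasons: the first
   contains neither neighbour of [i], the second contains both. *)
- move=> p; suff [] : s i (E p) = E p /\ s i (E p.+1) = E p.+1 by [].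
  by elim: p => // p [sEp sEp1]; split=> //; rewrite /E per2.
rewrite etau rmorphD rmorphB fmorph_div rmorph_nat rmorph_quad_sum -etau.
rewrite s_ksum sy_even (@quad_sum_perturb _ x _ a) //.
- rewrite /H /E (stride_sum_recl x) mulrDr divfK ?x0_neq0 //.
  by ring.
- exact: s_x1.
- by rewrite -ln; exact: s_xl.
- by rewrite -ln; exact: s_xm.
Qed.

Lemma s_commutes (phi : K) : s i (D R l phi) = D R l (s i phi).
Proof.
apply: commute_on_generators; [exact: s_automorphism|exact: D_derivation|].
apply: gens_ind => j; first exact: s_commutes_alpha.
have := odd_double_half l; case: (odd l) => /esym ln.
  exact: (@s_commutes_f_odd l./2).
exact: (@s_commutes_f_even l./2).
Qed.

End SimpleReflection.

End VectorField.

Theorem theorem1p2 (R : realType) (l : nat) (hl : (2 <= l)%N)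
    (w : ratfun R[i] (l.+1 + l.+1) -> ratfun R[i] (l.+1 + l.+1))
    (hw : ext_affine_weyl R l w)
    (phi : ratfun R[i] (l.+1 + l.+1)) :
  w (D R l phi) = D R l (w phi).
Proof.
elim: hw phi => [i||//|w1 w2 _ IH1 _ IH2|w1 w2 _ IH K1 K2] phi.
- exact: s_commutes.
- exact: pi_commutes.
- by rewrite /= IH2 IH1.
- by rewrite -[in LHS](K2 phi) -IH K1.
Qed.
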